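(* Let $Q$ be the stationary number of customers in the M/G/1 queue in which the arrival rate is resampled at every service completion. As $\rho\uparrow1$, $(1-\rho)Q$ converges in distribution to an exponentially distributed random variable with mean $\tfrac12\,\mathbb{E}[\Lambda^2]\,\mathbb{E}[S^2]$, where $\mathbb{E}[\Lambda^2]$ is evaluated in the limit $\rho\uparrow 1$.
   Context: Service times are i.i.d. copies of a non-negative random variable $S$; the arrival rate is resampled at every service completion, the arrival rates being i.i.d. copies of a non-negative random variable $\Lambda$, independent of the service times; $\mathbb{E}[\Lambda^2]<\infty$ and $\mathbb{E}[S^2]<\infty$. Let $N$ denote a generic number of customers arriving during a service time (conditionally on its arrival rate and service time, Poisson with mean equal to their product). The numbers $Q_n$ of customers present at successive service completions satisfy $Q_{n+1}=(Q_n-1)^++N_{n+1}$ in distribution, with $N_{n+1}$ a copy of $N$ independent of $Q_n$. For $\rho:=\mathbb{E}\Lambda\,\mathbb{E}S<1$, $Q$ denotes the stationary number of customers, i.e. the stationary version of $Q_n$, characterized by $Q=_{\mathrm d}(Q-1)^++N$ with the two terms on the right independent. Heavy-traffic regime: the law of $S$ is kept fixed and the arrival rate is scaled uniformly, i.e. $\Lambda=\rho\,\Lambda_1$ for a fixed non-negative random variable $\Lambda_1$ with $\mathbb{E}\Lambda_1\,\mathbb{E}S=1$, and $\rho\uparrow1$; thus in the limit $\mathbb{E}[\Lambda^2]=\mathbb{E}[\Lambda_1^2]$. *)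

(* Defs.v *)
From HB Require Import structures.
From mathcomp Require Import all_boot all_order all_algebra.
From mathcomp Require Import all_classical all_reals all_analysis measurable_realfun.

Set Implicit Arguments.
Unset Strict Implicit.
Unset Printing Implicit Defensive.

Import Order.TTheory GRing.Theory Num.Theory.
Import numFieldNormedType.Exports.

Local Open Scope classical_set_scope.
Local Open Scope ring_scope.

Definition independent_RV {d d1 d2 : measure_display} {T : measurableType d}
    {T1 : measurableType d1} {T2 : measurableType d2} {R : realType}
    (P : probability T R) (X : {RV P >-> T1}) (Y : {RV P >-> T2}) : Prop :=
  forall (A : set T1) (B : set T2), measurable A -> measurable B ->
    P (X @^-1` A `&` Y @^-1` B) = (P (X @^-1` A) * P (Y @^-1` B))%E.
Arguments independent_RV {d d1 d2 T T1 T2 R} P X Y.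

Definition eq_in_distribution {d d1 : measure_display} {T : measurableType d}
    {T1 : measurableType d1} {R : realType}
    (P : probability T R) (X Y : {RV P >-> T1}) : Prop :=
  forall A : set T1, measurable A -> distribution P X A = distribution P Y A.
Arguments eq_in_distribution {d d1 T T1 R} P X Y.

(* The quantification over B expresses that, conditionally on (Lam, S), N is
   Poisson with mean Lam * S.  In [poisson_prob r k A], the argument k is unused
   (A is the event), and [poisson_prob 0] is the Dirac mass at 0; [poisson_pmf]
   is avoided because it is constantly 1 at rate 0. *)
Definition mixed_poisson {d : measure_display} {T : measurableType d}
    {R : realType} (P : probability T R) (Lam S : {RV P >-> R})
    (N : {RV P >-> nat}) : Prop :=
  forall (A : set nat) (B : set (R * R)), measurable B ->
    P (N @^-1` A `&` (fun w => (Lam w, S w)) @^-1` B) =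
    (\int[P]_(w in (fun w => (Lam w, S w)) @^-1` B)
        poisson_prob (Lam w * S w)%R 0 A)%E.
Arguments mixed_poisson {d T R} P Lam S N.

(* Truncated predecessor: (Q - 1)^+ + N. *)
Definition lindley_step {T : Type} (Q N : T -> nat) : T -> nat :=
  fun w => ((Q w).-1 + N w)%N.

Section lindley_measurable.
Context {d : measure_display} {T : measurableType d}.
Variables Q N : {mfun T >-> nat}.

Lemma measurable_lindley_step : measurable_fun setT (lindley_step Q N).
Proof.
apply: measurable_fun_addn => //.
by apply: (@measurableT_comp _ _ _ _ _ _ predn).
Qed.

HB.instance Definition _ :=
  @isMeasurableFun.Build _ _ _ _ (lindley_step Q N) measurable_lindley_step.
End lindley_measurable.

(* Q is a stationary number of customers at service completions: one step of
   the recursion, driven by a copy N of the number of arrivals during a service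
   that is independent of Q, leaves its law invariant. *)
Record stationary_queue {d : measure_display} {T : measurableType d}
    {R : realType} (P : probability T R) (Lam S : {RV P >-> R})
    (N Q : {RV P >-> nat}) : Prop := StationaryQueue {
  arrivals_law : mixed_poisson P Lam S N ;
  queue_arrivals_indep : independent_RV P Q N ;
  queue_stationary : eq_in_distribution P Q (lindley_step Q N)
}.
Arguments stationary_queue {d T R} P Lam S N Q.

Definition scale_nat {R : realType} (c : R) (n : nat) : R := c * n%:R.

Lemma measurable_scale_nat {R : realType} (c : R) :
  measurable_fun setT (scale_nat c).
Proof. by []. Qed.

HB.instance Definition _ (R : realType) (c : R) :=
  @isMeasurableFun.Build _ _ _ _ (scale_nat c) (measurable_scale_nat c).

(* Convergence of the distribution functions of the X i, along F, at every
   continuity point of the distribution function of the law mu. *)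
Definition cvg_in_distribution {d : measure_display} {T : measurableType d}
    {R : realType} (P : probability T R) (I : Type) (F : set_system I)
    (X : I -> {RV P >-> R}) (mu : set R -> \bar R) : Prop :=
  forall x : R, {for x, continuous (fun y : R => mu `]-oo, y]%classic)} ->
    cdf (X i) x @[i --> F] --> mu `]-oo, x]%classic.
Arguments cvg_in_distribution {d T R} P {I} F X mu.

(* Main.v *)
(** Laplace transforms.  With [phi t = E exp (- t Lam1 S)], conditioning on the
    rates gives [E z^N = phi (rho (1 - z))], and stationarity gives
    [G(z) (phi (rho (1 - z)) - z) = (1 - z) P(Q = 0) phi (rho (1 - z))] for
    [G(z) = E z^Q].  Since [phi t = 1 - t + t^2 v / 2 + o(t^2)] with
    [v = E Lam1^2 E S^2], letting [z -> 1] at fixed [rho] yields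
    [P(Q = 0) = 1 - rho]; then [z = exp (- s (1 - rho))] and [rho -> 1] yield
    [G(z) -> 1 / (1 + s v / 2)], the transform of the exponential law.
    Convergence of transforms implies convergence in distribution because
    indicators of half-lines are approximated by polynomials in
    [exp (- s y)]. *)

Require Import Defs.
From HB Require Import structures.
From mathcomp Require Import all_boot all_order all_algebra.
From mathcomp Require Import all_classical all_reals all_analysis measurable_realfun.
From mathcomp Require Import ring lra.

Import Order.TTheory GRing.Theory Num.Theory.
Import numFieldNormedType.Exports.

Local Open Scope classical_set_scope.
Local Open Scope ring_scope.

(** * Continuity theorem for Laplace transforms *)

Section step_poly.
Context {R : realType}.

Lemma bernoulli_ge (x : R) n : -1 <= x -> 1 + n%:R * x <= (1 + x) ^+ n.
Proof.
move=> x1; elim: n => [|n IH]; first by rewrite mul0r addr0 expr0.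
rewrite exprS (le_trans _ (ler_wpM2l _ IH))//; last by lra.
have := sqr_ge0 x; have : 0 <= n%:R :> R by [].
by rewrite -natr1; nra.
Qed.

(* Hence [1 - (1 - u ^ n) ^ (2 ^ n)] converges to the indicator of [u > 1/2],
   uniformly away from [u = 1/2]. *)
Lemma step_poly_bounds (u : R) n : 0 <= u <= 1 ->
  (1 - u ^+ n) ^+ (2 ^ n) * (1 + (2 * u) ^+ n) <= 1 /\
  1 - (1 - u ^+ n) ^+ (2 ^ n) <= (2 * u) ^+ n.
Proof.
move=> /andP[u0 u1].
have v0 : 0 <= u ^+ n by rewrite exprn_ge0.
have v1 : u ^+ n <= 1 by rewrite exprn_ile1.
(* [(2 * u) ^+ n] becomes [2 ^ n] times [u ^+ n], so Bernoulli's inequality applies with exponent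
   [2 ^ n] at [- u ^+ n] and at [u ^+ n]. In the second case the product is at most
   [(1 - (u ^+ n) ^+ 2) ^+ (2 ^ n)], hence at most 1. *)
rewrite exprMn -natrX; split; last first.
  have := @bernoulli_ge (- u ^+ n) (2 ^ n) ltac:(lra); lra.
rewrite (le_trans (ler_wpM2l _ (@bernoulli_ge (u ^+ n) (2 ^ n) _)))//.
- by rewrite exprn_ge0// subr_ge0.
- by lra.
- by rewrite -exprMn exprn_ile1//; nra.
Qed.

(** The rate [s] places the threshold [u = 1/2] of the step polynomial at the midpoint [c] of [a]
    and [b]. Then [2 * u = expR (s * (c - y))], whose [n]-th power is at least [eta^-1] for [y <= a]
    and at most [eta] for [y >= b] once [n] is large. *)
Lemma expR_step_poly (a b eta : R) : 0 < b -> a < b -> 0 < eta ->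
  exists s (p : {poly R}), 0 < s /\ forall y, 0 <= y ->
    [/\ 0 <= p.[expR (- s * y)] <= 1,
        y <= a -> 1 - eta <= p.[expR (- s * y)] &
        b <= y -> p.[expR (- s * y)] <= eta].
Proof.
move=> b0 ab e0.
(* A negative [a] may be replaced by 0; the midpoint, and with it [s], is then positive. *)
wlog a0 : a ab / 0 <= a.
  move=> H; have [a0|/ltW a0] := leP 0 a; first exact: H.
  have [s [p [s0 sp]]] := H 0 b0 (lexx _).
  exists s, p; split => // y y0; have [H1 H2 H3] := sp y y0; split => // ya.
  by apply: H2; exact: le_trans a0.
pose c := (a + b) / 2; pose h := (b - a) / 2.
have c0 : 0 < c by rewrite /c; lra.
have h0 : 0 < h by rewrite /h; lra.
have l2 : 0 < ln 2 :> R by rewrite ln_gt0// ltr1n.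
pose s := ln 2 / c.
have s0 : 0 < s by rewrite divr_gt0.
(* This size of [n] suffices because [expR t >= 1 + t]. *)
have [n nsh] : exists n : nat, eta^-1 <= n%:R * (s * h).
  have sh0 : 0 < s * h by rewrite mulr_gt0.
  exists (Num.bound (eta * (s * h))^-1).
  rewrite -ler_pdivrMr// -invfM; apply/ltW/archi_boundP.
  by rewrite invr_ge0 ltW// mulr_gt0.
exists s, (1 - (1 - 'X^n) ^+ (2 ^ n)); split => // y y0.
set u := expR _.
have u01 : 0 <= u <= 1.
  by rewrite expR_ge0 -[leRHS]expR0 ler_expR mulNr oppr_le0 mulr_ge0// ltW.
have uE : (2 * u) ^+ n = expR (n%:R * (s * (c - y))).
  rewrite -[2 in LHS]lnK ?posrE//  /u -expRD -expRM_natl; congr (expR (_ * _)).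
  by rewrite mulrBr mulNr /s divfK// gt_eqF.
have /andP[u0 u1] := u01.
rewrite !hornerE.
have [H1 H2] := @step_poly_bounds u n u01.
have q0 : 0 <= (1 - u ^+ n) ^+ (2 ^ n).
  by rewrite exprn_ge0// subr_ge0 exprn_ile1.
have q1 : (1 - u ^+ n) ^+ (2 ^ n) <= 1.
  by rewrite exprn_ile1// ?subr_ge0 ?exprn_ile1// lerBlDr lerDl exprn_ge0.
have big t : h <= t -> eta^-1 <= expR (n%:R * (s * t)).
  move=> ht; rewrite (le_trans nsh)// (@le_trans _ _ (n%:R * (s * t)))//.
    by rewrite !ler_wpM2l// ltW.
  by rewrite (le_trans _ (expR_ge1Dx _))// lerDr.
split; first by lra.
- move=> ya; have := big (c - y); rewrite -uE => /(_ _) H.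
  have {}H : eta^-1 <= (2 * u) ^+ n by apply: H; rewrite /c /h; lra.
  (* With [w = (2 * u) ^+ n], the bounds [q * (1 + w) <= 1] and [eta * w >= 1] force [q <= eta]. *)
  have : 1 <= eta * (2 * u) ^+ n by rewrite -ler_pdivrMl// mulr1.
  set q := (1 - _) ^+ _ in H1 H2 q0 q1 *; set w := _ ^+ n in H H1 *.
  by nra.
- move=> yb; apply: (le_trans H2); rewrite uE.
  rewrite -[leRHS]invrK -opprB !mulrN expRN lef_pV2 ?posrE ?invr_gt0 ?expR_gt0//.
  by apply: big; rewrite /c /h; lra.
Qed.

End step_poly.

Lemma poly_bounded {R : realType} (p : {poly R}) :
  exists M, forall u, `|u| <= 1 -> `|p.[u]| <= M.
Proof.
elim/poly_ind: p => [|p c [M HM]]; first by exists 0 => u _; rewrite horner0 normr0.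
exists (M + `|c|) => u u1; rewrite !hornerE (le_trans (ler_normD _ _))// lerD2r.
by rewrite normrM (le_trans _ (HM u u1))// ler_piMr.
Qed.

Lemma Rintegral_probability_cst {d} {T : measurableType d} {R : realType}
    (P : probability T R) (c : R) : \int[P]_w c = c.
Proof.
rewrite Rintegral_cst// -[RHS]mulr1; congr (_ * _).
by rewrite [X in fine X](probability_setT P).
Qed.

Section laplace_transform.
Context {d} {T : measurableType d} {R : realType} {P : probability T R}.
Variable X : {RV P >-> R}.
Hypothesis X_ge0 : forall w, 0 <= X w.

Lemma integrable_poly_expR (s : R) (p : {poly R}) : 0 <= s ->
  P.-integrable setT (EFin \o fun w => p.[expR (- s * X w)]).
Proof.
move=> s0; apply: measurable_bounded_integrable => //.
- exact/fin_num_fun_lty/fin_num_measure.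
- apply: (measurableT_comp (f := horner p) (g := fun w => expR (- s * X w))).
    by apply: continuous_measurable_fun; exact: continuous_horner.
  by apply: measurableT_comp => //; exact: measurable_funM.
have [M HM] := poly_bounded p.
exists M; split; first exact: num_real.
move=> N MN w _; apply: (le_trans _ (ltW MN)); apply: HM.
rewrite ger0_norm ?expR_ge0// -[leRHS]expR0 ler_expR.
by rewrite mulNr oppr_le0 mulr_ge0.
Qed.

Lemma integrable_expR (s : R) : 0 <= s ->
  P.-integrable setT (EFin \o fun w => expR (- s * X w)).
Proof.
move=> s0; have := integrable_poly_expR s 'X s0.
by congr (P.-integrable _ _); apply/funext => w /=; rewrite hornerX.
Qed.

Lemma cdf_fin_num (x : R) : cdf X x \is a fin_num.
Proof. exact: fin_num_measure. Qed.

Lemma cdf_lt0 (x : R) : x < 0 -> fine (cdf X x) = 0.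
Proof.
move=> x0; rewrite /cdf /distribution /pushforward.
rewrite (_ : _ @^-1` _ = set0) ?measure0//.
apply/seteqP; split => // w /=; rewrite in_itv/= => Xx.
by have := le_lt_trans Xx x0; rewrite ltNge X_ge0.
Qed.

(** The integrand lies pointwise between the indicator of [X <= a] minus [eta] and the indicator of
    [X <= b] plus [eta]; integrate. *)
Lemma Rintegral_poly_expR_sandwich (s a b eta : R) (p : {poly R}) : 0 < s ->
  (forall y, 0 <= y -> [/\ 0 <= p.[expR (- s * y)] <= 1,
        y <= a -> 1 - eta <= p.[expR (- s * y)] &
        b <= y -> p.[expR (- s * y)] <= eta]) ->
  0 <= eta ->
  fine (cdf X a) - eta <= \int[P]_w p.[expR (- s * X w)] <=
  fine (cdf X b) + eta.
Proof.
move=> s0 Hp e0.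
have mX c : measurable (X @^-1` `]-oo, c]) by exact: measurable_funPTI.
have indE c : fine (cdf X c) = \int[P]_w \1_(X @^-1` `]-oo, c]) w.
  by rewrite /Rintegral integral_indic ?setIT.
have iind c : P.-integrable setT
    (EFin \o (\1_(X @^-1` `]-oo, c]) : T -> R)).
  exact: integrable_indic.
have icst c : P.-integrable setT (EFin \o (fun=> c)).
  exact: finite_measure_integrable_cst.
rewrite !indE -(Rintegral_probability_cst P eta).
rewrite -RintegralB// -RintegralD//; apply/andP; split; apply: le_Rintegral => //=.
- exact: (integrableB measurableT (iind a) (icst eta)).
- by apply: integrable_poly_expR; exact: ltW.
- move=> w _; rewrite indicE; have [/andP[H1 _] H2 _] := Hp _ (X_ge0 w).
  have [Xa|Xa] := boolP (_ \in _); last by rewrite sub0r (le_trans _ H1)// oppr_le0.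
  by apply: H2; move: Xa; rewrite inE/= in_itv.
- by apply: integrable_poly_expR; exact: ltW.
- exact: (integrableD measurableT (iind b) (icst eta)).
- move=> w _; rewrite indicE; have [/andP[_ H1] _ H2] := Hp _ (X_ge0 w).
  have [Xa|Xa] := boolP (_ \in _); first by rewrite (le_trans H1)// lerDl.
  rewrite add0r; apply: H2; move: Xa; rewrite notin_setE/= in_itv/=.
  by move/negP; rewrite -ltNge => /ltW.
Qed.

End laplace_transform.

(** * From convergence of transforms to convergence of distribution functions *)

Section laplace_continuity.
Context {d} {T : measurableType d} {R : realType} {P : probability T R}.
Context {d'} {T' : measurableType d'} {P' : probability T' R}.
Context {I : Type} {F : set_system I} {FF : ProperFilter F}.
Variables (X : I -> {RV P >-> R}) (Y : {RV P' >-> R}).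
Hypothesis X_ge0 : \forall i \near F, forall w, 0 <= X i w.
Hypothesis Y_ge0 : forall w, 0 <= Y w.
Hypothesis cvg_laplace : forall s, 0 < s ->
  \int[P]_w expR (- s * X i w) @[i --> F] --> \int[P']_w expR (- s * Y w).

(** By linearity only powers of [expR (- s * y)] matter, and the [k]-th power is the transform at
    [k%:R * s]. *)
Let cvg_poly s (p : {poly R}) : 0 < s ->
  \int[P]_w p.[expR (- s * X i w)] @[i --> F] -->
  \int[P']_w p.[expR (- s * Y w)].
Proof.
move=> s0.
(* The factor ['X^k] absorbs the ['X] that each induction step of [poly_ind] adds. *)
suff H k : \int[P]_w (p * 'X^k).[expR (- s * X i w)] @[i --> F] -->
  \int[P']_w (p * 'X^k).[expR (- s * Y w)].
  by have := H 0%N; rewrite expr0 mulr1.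
have powE (x : R) n : expR (- s * x) ^+ n = expR (- (n%:R * s) * x).
  by rewrite -expRM_natl mulrA mulrN.
have cst1 (g : I -> T -> R) (f' : T' -> R) (c : R) :
    (forall i w, g i w = c) -> (forall w, f' w = c) ->
    \int[P]_w g i w @[i --> F] --> \int[P']_w f' w.
  move=> gc f'c; rewrite (_ : f' = cst c); last exact/funext.
  rewrite (_ : g = fun=> cst c); last by apply/funext => i; exact/funext.
  by rewrite !Rintegral_probability_cst; exact: cvg_cst.
elim/poly_ind: p k => [|p c IH] k.
  by apply: (cst1 _ _ 0) => *; rewrite mul0r horner0.
have E d0 (T0 : measurableType d0) (P0 : probability T0 R) (Z : {RV P0 >-> R}) :
    (forall w, 0 <= Z w) ->
    \int[P0]_w ((p * 'X + c%:P) * 'X^k).[expR (- s * Z w)] =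
    \int[P0]_w (p * 'X^(k.+1)%N).[expR (- s * Z w)] +
    c * \int[P0]_w expR (- (k%:R * s) * Z w).
  move=> Z0.
  have ks : 0 <= k%:R * s by rewrite mulr_ge0// ltW.
  rewrite -RintegralZl//; last exact: integrable_expR.
  rewrite -RintegralD//; last 2 first.
  - by apply: integrable_poly_expR => //; exact: ltW.
  - exact: (integrableZl measurableT _ (integrable_expR _ Z0 _ ks)).
  apply: eq_Rintegral => w _; rewrite -powE !hornerE/=.
  by rewrite exprS mulrDl !mulrA.
rewrite E//; apply: cvg_trans.
  by apply: near_eq_cvg; near=> i; rewrite E//; near: i; exact: X_ge0.
apply: cvgD; first exact: IH.
apply: cvgMr; clear E.
(* [cvg_laplace] covers positive arguments only; for [k = 0] the integrand is the constant 1. *)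
case: k => [|k]; last by apply: cvg_laplace; rewrite mulr_gt0.
by apply: (cst1 _ _ 1) => *; rewrite mul0r oppr0 mul0r expR0.
Unshelve. all: by end_near. Qed.

Let near_cdf_le a b eta : 0 < b -> a < b -> 0 < eta ->
  \forall i \near F, fine (cdf (X i) a) <= fine (cdf Y b) + eta /\
                     fine (cdf Y a) <= fine (cdf (X i) b) + eta.
Proof.
(* One third for each of the two sandwiches, one for the distance between the two integrals. *)
move=> b0 ab e0; have e3 : 0 < eta / 3 by rewrite divr_gt0.
have [s [p [s0 Hp]]] := @expR_step_poly R a b _ b0 ab e3.
near=> i.
have Xi0 : forall w, 0 <= X i w by near: i; exact: X_ge0.
have /andP[Xa Xb] := Rintegral_poly_expR_sandwich (X i) Xi0 _ _ _ _ _ s0 Hp (ltW e3).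
have /andP[Ya Yb] := Rintegral_poly_expR_sandwich Y Y_ge0 _ _ _ _ _ s0 Hp (ltW e3).
have : `|\int[P']_w p.[expR (- s * Y w)] - \int[P]_w p.[expR (- s * X i w)]| < eta / 3.
  near: i; by move/cvgrPdist_lt : (cvg_poly s p s0); exact.
rewrite ltr_norml => /andP[h1 h2].
by split; lra.
Unshelve. all: by end_near. Qed.

(** Continuity at [x] supplies [h] such that moving by [h / 2] changes the limiting distribution
    function by less than [e / 2]; [near_cdf_le] between [x] and [x + h / 2], or [x - h / 2] and
    [x], costs the other [e / 2]. *)
Theorem laplace_cvg_in_distribution :
  cvg_in_distribution P F X (distribution P' Y).
Proof.
move=> x cx.
rewrite -[X in _ --> X]fineK; last exact: cdf_fin_num.
apply: cvg_EFin; first by apply: nearW => i; exact: cdf_fin_num.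
apply/cvgrPdist_le => e e0.
have e2 : 0 < e / 2 by rewrite divr_gt0.
have [h h0 Hh] : exists2 h, 0 < h & forall y, `|x - y| < h ->
    `|fine (cdf Y x) - fine (cdf Y y)| < e / 2.
  have : fine (cdf Y y) @[y --> x] --> fine (cdf Y x).
    by apply: fine_cvg; rewrite fineK ?cdf_fin_num//; exact: cx.
  move/cvgrPdist_lt => /(_ _ e2) [h /= h0 H]; exists h => // y; exact: H.
have h2 : 0 < h / 2 by rewrite divr_gt0.
have Hp : fine (cdf Y (x + h / 2)) <= fine (cdf Y x) + e / 2.
  have := Hh (x + h / 2); rewrite opprD addrA subrr sub0r normrN gtr0_norm//.
  by move=> /(_ ltac:(lra)); rewrite ltr_norml; lra.
have Hm : fine (cdf Y x) - e / 2 <= fine (cdf Y (x - h / 2)).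
  have := Hh (x - h / 2); rewrite opprB addrC subrK gtr0_norm//.
  by move=> /(_ ltac:(lra)); rewrite ltr_norml; lra.
have up : \forall i \near F, fine (cdf (X i) x) <= fine (cdf Y x) + e.
  have [x0|x0] := ltP x 0.
    near=> i; rewrite !cdf_lt0 ?add0r ?(ltW e0)//.
    by near: i; exact: X_ge0.
  have x1 : 0 < x + h / 2 by lra.
  apply: filterS (near_cdf_le x _ _ x1 _ e2); last by lra.
  by move=> i [H _]; lra.
have low : \forall i \near F, fine (cdf Y x) <= fine (cdf (X i) x) + e.
  (* [near_cdf_le] asks for a positive upper point, here [x]. If [x <= 0], the distribution function
     of [Y] vanishes at [x - h / 2], so it is at most [e / 2] at [x]. *)
  have [x0|x0] := leP x 0.
    near=> i; rewrite (cdf_lt0 Y Y_ge0 (x - h / 2)) in Hm => //; last by lra.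
    have : 0 <= fine (cdf (X i) x) by rewrite fine_ge0.
    by lra.
  apply: filterS (near_cdf_le (x - h / 2) _ _ x0 _ e2); last by lra.
  by move=> i [_ H]; lra.
near=> i; rewrite ler_norml; apply/andP; split.
  rewrite lerNl opprB lerBlDl; near: i; exact: up.
rewrite lerBlDl; near: i; exact: low.
Unshelve. all: by end_near. Qed.

End laplace_continuity.

(** * Transform of the exponential law *)

Section density.
Context {d} {T : measurableType d} {R : realType}.
Variables (nu : {finite_measure set T -> \bar R})
  (mu : {sigma_finite_measure set T -> \bar R}) (g : T -> R).
Hypothesis mg : measurable_fun setT g.
Hypothesis nuE : forall A, measurable A -> (nu A = \int[mu]_(x in A) (g x)%:E)%E.

(** [nu] is dominated by [mu], and [g] agrees almost everywhere with the Radon-Nikodym derivative,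
    both having the same integral over every measurable set. *)
Lemma integral_density (f : T -> \bar R) : nu.-integrable setT f ->
  (\int[nu]_x f x = \int[mu]_x (f x * (g x)%:E))%E.
Proof.
move=> nuf.
have numu : nu `<< mu.
  apply/null_content_dominatesP => A mA muA0; rewrite nuE//.
  by apply: null_set_integral => //; apply/measurable_EFinP/measurable_funTS.
have mf := measurable_int _ nuf.
rewrite -(Radon_Nikodym_change_of_variables numu)//=.
apply: ae_eq_integral => //.
- by apply: emeasurable_funM => //; apply: (measurable_int mu); exact: Radon_Nikodym_integrable.
- by apply: emeasurable_funM => //; exact/measurable_EFinP.
- apply: ae_eqe_mul2l => /=.
  rewrite Radon_NikodymE//=.
  case: cid => /= h [h1 h2 h3].
  apply: integral_ae_eq => //=.
  + exact/measurable_EFinP.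
  + by move=> E _ mE; rewrite -nuE//; exact/esym/h3.
Qed.

End density.

(* The truncation [Num.max x 0] makes the random variable nonnegative everywhere
   without changing its law, [exponential_pdf] being [0] on negative reals. *)
Lemma laplace_exponential {R : realType} (mu : probability (measurableTypeR R) R)
    (r s : R) : 0 < r -> 0 < s ->
  (forall A, measurable A -> mu A = exponential_prob r A) ->
  \int[mu]_x expR (- s * Num.max x 0) = r / (r + s).
Proof.
move=> r0 s0 muE.
have me : measurable_fun [set: R] (fun x : R => expR (- s * Num.max x 0)).
  apply: measurableT_comp => //; apply: measurable_funM => //.
  exact: measurable_maxr.
rewrite /Rintegral (integral_density mu (@lebesgue_measure R) (exponential_pdf r)).
(* Tilting the exponential density of rate [r] by [expR (- s * x)] gives [r / (r + s)] times the
   density of rate [r + s], which has mass 1. *)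
- rewrite (eq_integral (fun x : measurableTypeR R =>
      ((r / (r + s))%:E * (exponential_pdf (r + s) x)%:E)%E)).
    have rs : 0 < r + s by rewrite addr_gt0.
    rewrite ge0_integralZl//=.
    + by rewrite integral_exponential_pdf// mule1.
    + by apply/measurable_EFinP; exact: measurable_exponential_pdf.
    + by move=> x _; rewrite lee_fin exponential_pdf_ge0// ltW.
    + by rewrite lee_fin divr_ge0// ltW.
  move=> x _; rewrite -!EFinM; congr EFin.
  have [x0|x0] := ltP x 0; first by rewrite !lt0_exponential_pdf// !mulr0.
  rewrite !exponential_pdfE//= mulrCA mulrA.
  rewrite [RHS]mulrA divfK ?gt_eqF ?addr_gt0// -mulrA -expRD.
  by congr (_ * expR _); ring.
- exact: measurable_exponential_pdf.
- exact: muE.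
- apply: measurable_bounded_integrable => //.
  + exact/fin_num_fun_lty/fin_num_measure.
  + exists 1; split => // N N1 x _; apply: (le_trans _ (ltW N1)).
    rewrite ger0_norm ?expR_ge0// -[leRHS]expR0 ler_expR.
    by rewrite mulNr oppr_le0 mulr_ge0 ?(ltW s0)// le_max lexx orbT.
Qed.

(** * Generating function of the stationary queue *)

Section independence.
Context {d d1 d2} {T : measurableType d} {T1 : measurableType d1}
  {T2 : measurableType d2} {R : realType} {P : probability T R}.
Variables (X : {RV P >-> T1}) (Y : {RV P >-> T2}).
Hypothesis XY : independent_RV P X Y.

(** The joint law agrees with the product of the marginals on rectangles, hence everywhere; Tonelli
    then splits the integral. *)
Lemma integral_independent_prod (f : T1 -> \bar R) (g : T2 -> \bar R) :
  measurable_fun setT f -> measurable_fun setT g ->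
  (forall x, 0 <= f x)%E -> (forall y, 0 <= g y)%E ->
  (\int[P]_w (f (X w) * g (Y w)) = \int[P]_w f (X w) * \int[P]_w g (Y w))%E.
Proof.
move=> mf mg f0 g0.
have mZ : measurable_fun setT (fun w => (X w, Y w)) by exact: measurable_fun_pair.
pose Z : {mfun T >-> (T1 * T2)%type} := mfun_Sub (mem_set mZ).
have ZE : forall A, measurable A ->
    (distribution P X \x distribution P Y)%E A = distribution P Z A.
  apply: product_measure_unique => A B mA mB.
  by rewrite /distribution /= /pushforward -XY.
have mfg : measurable_fun setT (fun z : T1 * T2 => (f z.1 * g z.2)%E).
  by apply: emeasurable_funM; apply: measurableT_comp.
have fg0 : forall z : T1 * T2, (0 <= f z.1 * g z.2)%E by move=> z; rewrite mule_ge0.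
transitivity (\int[distribution P Z]_z (f z.1 * g z.2))%E.
  by rewrite ge0_integral_distribution.
transitivity (\int[distribution P X \x distribution P Y]_z (f z.1 * g z.2))%E.
  by apply: eq_measure_integral => A mA _; exact/esym/ZE.
rewrite fubini_tonelli1//= /fubini_F/=.
under eq_integral do rewrite ge0_integralZl//.
rewrite ge0_integralZr//=; last exact: integral_ge0.
by rewrite !ge0_integral_distribution.
Qed.

End independence.

Section discrete.
Context {d} {T : measurableType d} {R : realType} {P : probability T R}.

Lemma integral_nat_RV (N : {RV P >-> nat}) (f : nat -> \bar R) :
  (forall n, 0 <= f n)%E ->
  (\int[P]_w f (N w) = \sum_(n <oo) f n * P (N @^-1` [set n]))%E.
Proof.
move=> f0.
have mN n : measurable (N @^-1` [set n]) by exact: measurable_funPTI.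
have NT : \bigcup_n (N @^-1` [set n]) = setT.
  by apply/seteqP; split => // w _; exists (N w).
rewrite -NT ge0_integral_bigcup//.
- apply: eq_eseriesr => n _; rewrite -integral_cst//.
  by apply: eq_integral => w; rewrite inE/= => ->.
- by rewrite NT; apply: (measurableT_comp (f := f)).
- by move=> i j _ _ [w [/= <- <-]].
Qed.

Lemma poisson_prob_set1 (rate : R) n : 0 <= rate ->
  poisson_prob rate 0 [set n] = (rate ^+ n * n`!%:R^-1 * expR (- rate))%:E.
Proof.
rewrite /poisson_prob /poisson_pmf; have [r0 _|r0 r1] := ltP 0 rate.
  by rewrite esum_set1// lee_fin !mulr_ge0 ?exprn_ge0 ?expR_ge0 ?(ltW r0).
(* At rate 0 the law is the Dirac mass at 0, and the formula persists since [0 ^+ 0 = 1]. *)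
have -> : rate = 0 by apply/eqP; rewrite eq_le r0.
rewrite diracE oppr0 expR0 mulr1 expr0n.
case: n => [|n]; first by rewrite mem_set//= fact0 invr1 mulr1.
by rewrite memNset//= mul0r.
Qed.

(** Sum over the values of [N], exchange sum and integral by nonnegativity, and recognize for each
    [w] the exponential series of [z * l], where [l = Lam w * S w]. *)
Lemma mixed_poisson_pgf (Lam S : {RV P >-> R}) (N : {RV P >-> nat}) (z : R) :
  (forall w, 0 <= Lam w) -> (forall w, 0 <= S w) -> mixed_poisson P Lam S N ->
  0 <= z ->
  (\int[P]_w (z ^+ N w)%:E = \int[P]_w (expR (- (1 - z) * (Lam w * S w)))%:E)%E.
Proof.
move=> L0 S0 mp z0.
have LS0 w : 0 <= Lam w * S w by rewrite mulr_ge0.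
rewrite (integral_nat_RV N (fun n => (z ^+ n)%:E)); last first.
  by move=> n; rewrite lee_fin exprn_ge0.
pose h n w := z ^+ n * ((Lam w * S w) ^+ n * n`!%:R^-1 * expR (- (Lam w * S w))).
have h0 n w : 0 <= h n w by rewrite !mulr_ge0 ?exprn_ge0.
have mP n : measurable_fun setT (fun w =>
   (Lam w * S w) ^+ n * n`!%:R^-1 * expR (- (Lam w * S w))).
  apply: measurable_funM.
    by apply: measurable_funM => //; apply: measurable_funX; exact: measurable_funM.
  by apply: measurableT_comp => //; apply: measurableT_comp => //; exact: measurable_funM.
transitivity (\sum_(n <oo) \int[P]_w (h n w)%:E)%E.
  apply: eq_eseriesr => n _.
  have := mp [set n] setT measurableT; rewrite preimage_setT setIT => ->.
  under eq_integral do rewrite poisson_prob_set1//.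
  rewrite -ge0_integralZl//.
  - exact/measurable_EFinP.
  - by move=> w _; rewrite lee_fin !mulr_ge0 ?exprn_ge0.
  - by rewrite lee_fin exprn_ge0.
rewrite -integral_nneseries//.
- apply: eq_integral => w _; set l := Lam w * S w.
  rewrite (_ : - (1 - z) * l = - l + z * l); last by ring.
  rewrite expRD EFinM.
  transitivity (\sum_(n <oo) ((expR (- l))%:E * ((z * l) ^+ n / n`!%:R)%:E))%E.
    by apply: eq_eseriesr => n _; rewrite -EFinM /h -/l (exprMn _ z l) [in LHS]mulrA [in LHS]mulrC !mulrA.
  rewrite nneseriesZl; last by move=> n _; rewrite lee_fin divr_ge0 ?exprn_ge0 ?mulr_ge0.
  congr (_ * _)%E; rewrite expRE -EFin_lim; last first.
    rewrite /pseries/=; under eq_fun do rewrite mulrC.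
    exact: is_cvg_series_exp_coeff.
  apply/congr_lim/funext => n/=; rewrite /pseries/= /series/= -sumEFin//.
  by under eq_bigr do rewrite mulrC.
- by move=> n; apply/measurable_EFinP; exact: measurable_funM.
- by move=> n w _; rewrite lee_fin.
Qed.

End discrete.

(** * Alternating Taylor bounds for [expR (- x)], each obtained by integrating the previous one *)

Section taylor.
Context {R : realType}.
Implicit Type x : R.

Lemma ge0_of_derive (f df : R -> R) x : 0 <= x -> f 0 = 0 ->
  (forall y : R, is_derive y 1 f (df y)) -> (forall y, 0 <= y -> 0 <= df y) ->
  0 <= f x.
Proof.
move=> x0 f0 fdf df0.
have cf : {within `[0, x], continuous f}.
  by apply: derivable_within_continuous => y _; have [] := fdf y.
have [c] := MVT_segment x0 (fun y _ => fdf y) cf.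
rewrite in_itv/= f0 !subr0 => /andP[c0 _] ->.
by rewrite mulr_ge0// df0.
Qed.

Lemma is_derive_expRN x : is_derive x 1 (fun y => expR (- y)) (- expR (- x)).
Proof.
apply: is_derive_eq.
by rewrite /GRing.scale /= mulrN1.
Qed.

Lemma expRN_ge1B x : 1 - x <= expR (- x).
Proof. exact: expR_ge1Dx. Qed.

Lemma expRN_le_taylor2 x : 0 <= x -> expR (- x) <= 1 - x + x ^+ 2 / 2.
Proof.
move=> x0; rewrite -subr_ge0.
apply: (@ge0_of_derive (fun y => 1 - y + y ^+ 2 / 2 - expR (- y))
  (fun y => -1 + y + expR (- y))) => //.
- by rewrite oppr0 expR0; ring.
- move=> y; have := is_derive_expRN y => H.
  by apply: is_derive_eq; rewrite /GRing.scale/=; field.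
- by move=> y _; have := expRN_ge1B y; lra.
Qed.

Lemma expRN_ge_taylor3 x : 0 <= x ->
  1 - x + x ^+ 2 / 2 - x ^+ 3 / 6 <= expR (- x).
Proof.
move=> x0; rewrite -subr_ge0.
apply: (@ge0_of_derive (fun y => expR (- y) - (1 - y + y ^+ 2 / 2 - y ^+ 3 / 6))
  (fun y => - expR (- y) + 1 - y + y ^+ 2 / 2)) => //.
- by rewrite oppr0 expR0; ring.
- move=> y; have := is_derive_expRN y => H.
  by apply: is_derive_eq; rewrite /GRing.scale/=; field.
- by move=> y y0; have := expRN_le_taylor2 y y0; lra.
Qed.

End taylor.

(** * Functional equation for the stationary generating function *)

Section recursion.
Context {d} {T : measurableType d} {R : realType} {P : probability T R}.

Lemma integrable_bounded1 (f : T -> R) : measurable_fun setT f ->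
  (forall w, 0 <= f w <= 1) -> P.-integrable setT (EFin \o f).
Proof.
move=> mf f01; apply: measurable_bounded_integrable => //.
- exact/fin_num_fun_lty/fin_num_measure.
- exists 1; split => // M M1 w _; apply: (le_trans _ (ltW M1)).
  by have /andP[f0 f1] := f01 w; rewrite ger0_norm.
Qed.

Variables (Lam S : {RV P >-> R}) (N Q : {RV P >-> nat}).
Hypothesis st : stationary_queue P Lam S N Q.

Let mnat (f : nat -> R) (Z : {RV P >-> nat}) : measurable_fun setT (fun w => f (Z w)).
Proof. exact: (measurableT_comp (f := f)). Qed.

Let znat (z : R) (n : nat) : 0 <= z <= 1 -> 0 <= z ^+ n <= 1.
Proof. by move=> /andP[z0 z1]; rewrite exprn_ge0//= exprn_ile1. Qed.

(** Stationarity and independence factor the transform of [Q] as that of [(Q w).-1] times that of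
    [N]. Multiplying by [z] undoes the predecessor except on the event [Q w = 0], which produces the
    correction term. *)
Lemma stationary_pgf (z : R) : 0 <= z <= 1 ->
  z * \int[P]_w z ^+ Q w =
  (\int[P]_w z ^+ Q w - (1 - z) * fine (P (Q @^-1` [set 0%N]))) *
  \int[P]_w z ^+ N w.
Proof.
move=> z01; have /andP[z0 z1] := z01.
have zi (f : nat -> nat) (Z : {RV P >-> nat}) :
    P.-integrable setT (EFin \o fun w => z ^+ f (Z w)).
  by apply: integrable_bounded1 => *; [exact: (mnat (fun n => z ^+ f n))|exact: znat].
have GHA : \int[P]_w z ^+ Q w = \int[P]_w z ^+ (Q w).-1 * \int[P]_w z ^+ N w.
  rewrite /Rintegral -fineM; last 2 first.
  - exact: integrable_fin_num (zi predn Q).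
  - exact: integrable_fin_num (zi id N).
  congr fine.
  rewrite -(integral_independent_prod Q N (queue_arrivals_indep st)
    (fun n => (z ^+ n.-1)%:E) (fun n => (z ^+ n)%:E))//; last 2 first.
  - by move=> n; rewrite lee_fin exprn_ge0.
  - by move=> n; rewrite lee_fin exprn_ge0.
  have z0E n : (0 <= (z ^+ n)%:E)%E by rewrite lee_fin exprn_ge0.
  rewrite -(ge0_integral_distribution Q (f := fun n => (z ^+ n)%:E))//.
  transitivity (\int[distribution P (lindley_step Q N : {mfun T >-> nat})]_n (z ^+ n)%:E)%E.
    by apply: eq_measure_integral => A mA _; exact: (queue_stationary st).
  rewrite ge0_integral_distribution//.
  by apply: eq_integral => w _; rewrite -EFinM -exprD.
have mQ0 : measurable (Q @^-1` [set 0%N]) by exact: measurable_funPTI.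
have zH : z * \int[P]_w z ^+ (Q w).-1 =
  \int[P]_w z ^+ Q w - (1 - z) * fine (P (Q @^-1` [set 0%N])).
  have -> : fine (P (Q @^-1` [set 0%N])) = \int[P]_w \1_(Q @^-1` [set 0%N]) w.
    by rewrite /Rintegral integral_indic ?setIT.
  have i0 : P.-integrable setT (EFin \o (\1_(Q @^-1` [set 0%N]) : T -> R)).
    exact: integrable_indic.
  rewrite -(RintegralZl _ measurableT (zi predn Q)) -(RintegralZl _ measurableT i0).
  rewrite -RintegralB//; last 2 first.
  - exact: (zi id).
  - exact: (integrableZl measurableT _ i0).
  apply: eq_Rintegral => w _; rewrite indicE.
  (* As [0.-1 = 0], both sides equal [z] when the queue is empty. *)
  have [Q0|Q0] := eqVneq (Q w) 0%N.
    by rewrite Q0 mem_set// !expr0 !mulr1 opprB addrC subrK.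
  by rewrite memNset/= ?mulr0 ?subr0 -?exprS ?prednK ?lt0n//; exact/eqP.
by rewrite {1}GHA mulrA zH.
Qed.

(** Dominated convergence with bound 1: [Q w] is a finite number, so each power tends to 1. *)
Lemma stationary_pgf_cvg1 : \int[P]_w (1 - n.+1%:R^-1) ^+ Q w @[n --> \oo] --> (1 : R).
Proof.
have u01 n : 0 <= (1 - n.+1%:R^-1 : R) <= 1.
  by rewrite subr_ge0 invf_le1// ler1n/= lerBlDr lerDl invr_ge0.
apply: fine_cvg.
have -> : 1%:E = (\int[P]_w (cst 1%:E : T -> \bar R) w)%E.
  by rewrite integral_cst// mul1e; exact/esym/probability_setT.
have [] := @dominated_convergence _ _ _ P setT measurableT
  (fun n w => ((1 - n.+1%:R^-1) ^+ Q w)%:E) (cst 1%:E) (cst 1%:E).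
- by move=> n; apply/measurable_EFinP; exact: (mnat (fun k => (1 - n.+1%:R^-1) ^+ k)).
- by [].
- apply: aeW => w _; apply: cvg_EFin; first exact: nearW.
  rewrite [X in _ --> X](_ : _ = (1 - 0) ^+ Q w); last by rewrite subr0 expr1n.
  have c1 : (1 - n.+1%:R^-1) @[n --> \oo] --> (1 - 0 : R).
    by apply: cvgB; [exact: cvg_cst|exact: cvg_harmonic].
  exact: (cvg_comp _ _ c1 (@exprn_continuous _ (Q w) _)).
- exact: finite_measure_integrable_cst.
- apply: aeW => w n _; rewrite lee_fin.
  by have /andP[h0 h1] := znat _ (Q w) (u01 n); rewrite ger0_norm.
- by [].
Qed.

End recursion.

(** * Second-order expansion of a Laplace transform at 0 *)

Section laplace_expansion.
Context {d} {T : measurableType d} {R : realType} {P : probability T R}.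
Variable Y : {RV P >-> R}.
Hypothesis Y_ge0 : forall w, 0 <= Y w.
Hypothesis Y_sq : P.-integrable setT (EFin \o fun w => Y w ^+ 2).

Lemma integrable_of_sqr : P.-integrable setT (EFin \o Y).
Proof.
have i1 : P.-integrable setT (EFin \o fun w => 1 + Y w ^+ 2).
  exact: (integrableD measurableT (finite_measure_integrable_cst P 1 measurableT) Y_sq).
apply: le_integrable i1 => //; first exact/measurable_EFinP.
move=> w _; rewrite lee_fin !ger0_norm//.
  by have := Y_ge0 w; have := sqr_ge0 (Y w - 1); nra.
by rewrite addr_ge0// sqr_ge0.
Qed.

Let rest (t y : R) := (expR (- t * y) - 1 + t * y) / t ^+ 2.

(** This bound, uniform in [t], is the domination used in [laplace_expansion]. The cubic Taylor
    bound serves only for the pointwise limit [rest_cvg]. *)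
Let rest_bound (t y : R) : 0 < t -> 0 <= y -> 0 <= rest t y <= y ^+ 2 / 2.
Proof.
move=> t0 y0; rewrite /rest mulNr.
have ty0 : 0 <= t * y by rewrite mulr_ge0// ltW.
have := expRN_ge1B (t * y); have := expRN_le_taylor2 _ ty0.
set e := expR _ => h1 h2; apply/andP; split.
  by rewrite divr_ge0 ?sqr_ge0//; lra.
rewrite ler_pdivrMr ?exprn_gt0//.
by rewrite (_ : y ^+ 2 / 2 * t ^+ 2 = (t * y) ^+ 2 / 2); [lra|ring].
Qed.

Let rest_cvg (y : R) : 0 <= y -> rest t y @[t --> 0^'+] --> y ^+ 2 / 2.
Proof.
move=> y0.
have lb : y ^+ 2 / 2 - t * (y ^+ 3 / 6) @[t --> 0^'+] --> y ^+ 2 / 2.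
  rewrite -[X in _ --> X]subr0; apply: cvgB; first exact: cvg_cst.
  rewrite -[X in _ --> X](mul0r (y ^+ 3 / 6)); apply: cvgMl.
  exact: (@cvg_at_right_filter _ _ id).
apply: squeeze_cvgr lb (cvg_cst _).
near=> t.
have t0 : 0 < t by near: t; exact: nbhs_right_gt.
have /andP[_ ->] := rest_bound t y t0 y0; rewrite andbT /rest mulNr.
rewrite ler_pdivlMr ?exprn_gt0//.
have ty0 : 0 <= t * y by rewrite mulr_ge0// ltW.
have := expRN_ge_taylor3 _ ty0.
rewrite (_ : (y ^+ 2 / 2 - t * (y ^+ 3 / 6)) * t ^+ 2 = (t * y) ^+ 2 / 2 - (t * y) ^+ 3 / 6).
  lra.
by field.
Unshelve. all: by end_near. Qed.

(** The quotient is the integral of [rest t (Y w)]; dominated convergence applies along every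
    positive sequence tending to 0. The mean is left general because the expansion serves both at
    load [rho] and at load 1. *)
Lemma laplace_expansion :
  (\int[P]_w expR (- t * Y w) - 1 + t * \int[P]_w Y w) / t ^+ 2 @[t --> 0^'+]
  --> (\int[P]_w Y w ^+ 2) / 2.
Proof.
apply/cvg_at_rightP => u [u0 ucvg].
have iY := integrable_of_sqr.
have iE n : P.-integrable setT (EFin \o fun w => expR (- u n * Y w)).
  by apply: integrable_expR => //; exact: ltW.
have iY2 : P.-integrable setT (EFin \o fun w => Y w ^+ 2 / 2).
  exact: (integrableZr measurableT _ Y_sq).
have icst : P.-integrable setT (EFin \o (fun=> 1 : R)).
  exact: finite_measure_integrable_cst.
have iEB n : P.-integrable setT (EFin \o (fun w => expR (- u n * Y w) - 1)).
  exact: (integrableB measurableT (iE n) icst).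
have itY n : P.-integrable setT (EFin \o (fun w => u n * Y w)).
  exact: (integrableZl measurableT _ iY).
have iEBY n : P.-integrable setT
    (EFin \o (fun w => expR (- u n * Y w) - 1 + u n * Y w)).
  exact: (integrableD measurableT (iEB n) (itY n)).
have restE n : (\int[P]_w expR (- u n * Y w) - 1 + u n * \int[P]_w Y w) / u n ^+ 2 =
    \int[P]_w rest (u n) (Y w).
  rewrite (RintegralZr _ measurableT (iEBY n)) (RintegralD measurableT (iEB n) (itY n)).
  rewrite (RintegralZl _ measurableT iY) (RintegralB measurableT (iE n) icst).
  by rewrite Rintegral_probability_cst.
under eq_fun do rewrite restE.
rewrite -(RintegralZr _ measurableT Y_sq).
apply: fine_cvg; rewrite fineK; last exact: integrable_fin_num iY2.
have [] := @dominated_convergence _ _ _ P setT measurableT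
  (fun n w => (rest (u n) (Y w))%:E) (fun w => (Y w ^+ 2 / 2)%:E) (fun w => (Y w ^+ 2 / 2)%:E).
- move=> n; apply: (measurable_int P); exact: (integrableZr measurableT _ (iEBY n)).
- exact: measurable_int iY2.
- apply: aeW => w _; apply: cvg_EFin; first exact: nearW.
  by have /cvg_at_rightP := rest_cvg (Y w) (Y_ge0 w); exact.
- exact: iY2.
- apply: aeW => w n _; rewrite lee_fin.
  by have /andP[h0 h1] := rest_bound (u n) (Y w) (u0 n) (Y_ge0 w); rewrite ger0_norm.
- by [].
Qed.

End laplace_expansion.

(** * The probability of an empty system *)

Section empty_prob.
Context {d} {T : measurableType d} {R : realType} {P : probability T R}.
Variables (Lam S : {RV P >-> R}) (N Q : {RV P >-> nat}).
Hypothesis st : stationary_queue P Lam S N Q.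
Variable Y : {RV P >-> R}.
Hypothesis Lam_ge0 : forall w, 0 <= Lam w.
Hypothesis S_ge0 : forall w, 0 <= S w.
Hypothesis YE : forall w, Y w = Lam w * S w.
Hypothesis Y_sq : P.-integrable setT (EFin \o fun w => Y w ^+ 2).

Lemma stationary_pgf_laplace (x : R) : 0 <= x <= 1 ->
  \int[P]_w (1 - x) ^+ Q w * (\int[P]_w expR (- x * Y w) - 1 + x) =
  x * fine (P (Q @^-1` [set 0%N])) * \int[P]_w expR (- x * Y w).
Proof.
move=> /andP[x0 x1].
have NE : \int[P]_w (1 - x) ^+ N w = \int[P]_w expR (- x * Y w).
  rewrite /Rintegral (mixed_poisson_pgf Lam S)//.
  - by congr fine; apply: eq_integral => w _; rewrite YE opprB addrAC subrr add0r.
  - exact: (arrivals_law st).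
  - by rewrite subr_ge0.
have x01 : 0 <= 1 - x <= 1 by rewrite subr_ge0 x1 lerBlDr lerDl.
have := stationary_pgf Lam S N Q st (1 - x) x01.
rewrite NE; move: (Rintegral _ _ _) (Rintegral _ _ _) (fine _) => G A p H.
by rewrite (_ : A * (G - 1 + x) = A * G - (1 - x) * A); [rewrite H; ring|ring].
Qed.

(** After division by [x], [stationary_pgf_laplace] has left factor [1 - m + x * r], where [r] is
    the second-order quotient. As [r] converges, letting [x] tend to 0 leaves [1 - m] on the left
    and [p] on the right. *)
Lemma stationary_empty_prob :
  fine (P (Q @^-1` [set 0%N])) = 1 - \int[P]_w Y w.
Proof.
have Y_ge0 w : 0 <= Y w by rewrite YE mulr_ge0.
set p := fine _; set m := Rintegral _ _ _.
pose x n : R := n.+1%:R^-1.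
have x0 n : 0 < x n by rewrite invr_gt0.
have x1 n : x n <= 1 by rewrite invf_le1// ler1n.
have xc : x n @[n --> \oo] --> 0 by exact: cvg_harmonic.
pose A n := \int[P]_w expR (- x n * Y w).
pose r n := (A n - 1 + x n * m) / x n ^+ 2.
have rc : cvgn r.
  have /cvg_at_rightP H := laplace_expansion Y Y_ge0 Y_sq.
  by apply/cvg_ex; eexists; apply: H.
have AE n : A n = 1 - x n * m + x n * (x n * r n).
  by rewrite /r mulrA -expr2 [X in _ + X]mulrC divfK ?expf_neq0 ?gt_eqF//; ring.
have E n : (\int[P]_w (1 - x n) ^+ Q w) * (1 - m + x n * r n) = p * A n.
  have x01 : 0 <= x n <= 1 by rewrite ltW//= x1.
  have := stationary_pgf_laplace (x n) x01; rewrite -/p -/(A n).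
  rewrite [X in _ * X](_ : _ = x n * (1 - m + x n * r n)); last by rewrite AE; ring.
  rewrite mulrCA -[RHS]mulrA => /mulfI; apply; by rewrite gt_eqF.
have xr : x n * r n @[n --> \oo] --> 0.
  by rewrite -(mul0r (limn r)); apply: cvgM.
have lhs : (\int[P]_w (1 - x n) ^+ Q w) * (1 - m + x n * r n) @[n --> \oo] --> 1 * (1 - m + 0).
  apply: cvgM; first exact: (stationary_pgf_cvg1 Q).
  by apply: cvgD => //; exact: cvg_cst.
have rhs : p * (1 - x n * m + x n * (x n * r n)) @[n --> \oo] --> p * (1 - 0 * m + 0 * 0).
  apply: cvgMr.
  apply: cvgD; last exact: cvgM.
  by apply: cvgB; [exact: cvg_cst|exact: cvgMl].
move: lhs; under eq_fun do rewrite E AE.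
move=> /(cvg_unique _ rhs); rewrite mul1r !mul0r subr0 !addr0 mulr1; exact.
Qed.

End empty_prob.

(** * Heavy traffic *)

Section heavy_traffic.
Context {d} {T : measurableType d} {R : realType} {P : probability T R}.
Variables (Lam1 S : {RV P >-> R}) (N Q : R -> {RV P >-> nat}) (Y : {RV P >-> R}).
Hypothesis Lam1_ge0 : forall w, 0 <= Lam1 w.
Hypothesis S_ge0 : forall w, 0 <= S w.
Hypothesis YE : forall w, Y w = Lam1 w * S w.
Hypothesis Y_sq : P.-integrable setT (EFin \o fun w => Y w ^+ 2).
Hypothesis Y_mean : \int[P]_w Y w = 1.
Hypothesis stationary : forall rho : R, 0 < rho < 1 ->
  stationary_queue P (rho \o* Lam1 : {mfun T >-> R}) S (N rho) (Q rho).

Let Y_ge0 w : 0 <= Y w. Proof. by rewrite YE mulr_ge0. Qed.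
Let phi (t : R) := \int[P]_w expR (- t * Y w).
Let r (t : R) := (phi t - 1 + t) / t ^+ 2.

Let phiE t : t != 0 -> phi t = 1 - t + t ^+ 2 * r t.
Proof. by move=> t0; rewrite /r [X in _ + X]mulrC divfK ?expf_neq0//; ring. Qed.

(** Integrating [1 - t * y <= expR (- t * y)] with mean 1 gives the sign, which keeps the
    denominator in [heavy_traffic_pgf] positive. *)
Let r_ge0 t : 0 < t -> 0 <= r t.
Proof.
move=> t0; rewrite /r divr_ge0 ?sqr_ge0//.
have iY := integrable_of_sqr Y Y_ge0 Y_sq.
have : \int[P]_w (1 - t * Y w) <= phi t.
  apply: le_Rintegral => //.
  - exact: (integrableB measurableT (finite_measure_integrable_cst P 1 measurableT)
     (integrableZl measurableT t iY)).
  - by apply: integrable_expR => //; exact: ltW.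
  - by move=> w _; rewrite mulNr; exact: expRN_ge1B.
rewrite (RintegralB measurableT (finite_measure_integrable_cst P 1 measurableT)
     (integrableZl measurableT t iY)) (RintegralZl _ measurableT iY).
by rewrite Rintegral_probability_cst Y_mean; lra.
Qed.

(** With [t = rho * x], the factor [phi t - 1 + x] equals [x * (1 - rho) + t ^+ 2 * r t]. The empty
    probability being [1 - rho], dividing by [x * (1 - rho)] leaves only quantities with a limit in
    heavy traffic. *)
Lemma heavy_traffic_pgf (rho x : R) : 0 < rho < 1 -> 0 < x <= 1 ->
  \int[P]_w (1 - x) ^+ Q rho w =
  phi (rho * x) / (1 + rho ^+ 2 * (x / (1 - rho)) * r (rho * x)).
Proof.
move=> rho01 /andP[x0 x1]; have st := stationary _ rho01.
have /andP[rho0 rho1] := rho01.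
have iY := integrable_of_sqr Y Y_ge0 Y_sq.
pose Yr : {RV P >-> R} := rho \o* Y.
have Lr0 w : 0 <= (rho \o* Lam1) w by rewrite /= mulr_ge0// ltW.
have YrE w : Yr w = (rho \o* Lam1) w * S w by rewrite /= YE mulrAC.
have Yr_sq : P.-integrable setT (EFin \o fun w => Yr w ^+ 2).
  have := integrableZr measurableT (rho ^+ 2) Y_sq.
  by congr (P.-integrable _ _); apply/funext => w /=; rewrite exprMn EFinM.
have x01 : 0 <= x <= 1 by rewrite ltW.
have := stationary_pgf_laplace _ _ _ _ st Yr Lr0 S_ge0 YrE x x01.
rewrite (stationary_empty_prob _ _ _ _ st Yr Lr0 S_ge0 YrE Yr_sq).
rewrite (RintegralZr _ measurableT iY) Y_mean mul1r.
have -> : \int[P]_w expR (- x * Yr w) = phi (rho * x).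
  by apply: eq_Rintegral => w _; congr expR; rewrite /Yr/=; ring.
have t0 : 0 < rho * x by rewrite mulr_gt0.
have D1 : 0 < 1 - rho by rewrite subr_gt0.
have rt := r_ge0 _ t0.
have D0 : 0 < 1 + rho ^+ 2 * (x / (1 - rho)) * r (rho * x).
  by rewrite ltr_pwDl// mulr_ge0// mulr_ge0 ?sqr_ge0// divr_ge0// ltW.
have xr0 : x * (1 - rho) != 0 by rewrite gt_eqF// mulr_gt0.
move=> H; apply: (canRL (mulfK _)); first by rewrite gt_eqF.
apply: (mulfI xr0); rewrite -H mulrCA; congr (_ * _).
rewrite {1}phiE ?gt_eqF//; move: (r _) => q; field.
by rewrite gt_eqF.
Qed.

(** The choice of [x rho] turns [(1 - x rho) ^+ n] into the exponential of [- s * (1 - rho) * n].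
    Then [x rho / (1 - rho)] tends to [s], and [rho * x rho] to 0 from the right, so every factor of
    [heavy_traffic_pgf] converges. *)
Lemma heavy_traffic_laplace (s : R) : 0 < s ->
  \int[P]_w expR (- s * (scale_nat (1 - rho) \o Q rho) w) @[rho --> 1^'-] -->
  (1 + s * ((\int[P]_w Y w ^+ 2) / 2))^-1.
Proof.
move=> s0; pose x (rho : R) := 1 - expR (- (s * (1 - rho))).
have x01 rho : rho < 1 -> 0 < x rho <= 1.
  move=> rho1; apply/andP; split; rewrite /x.
    by rewrite subr_gt0 expR_lt1 oppr_lt0 mulr_gt0// subr_gt0.
  by rewrite gerBl expR_ge0.
have idc : (rho : R) @[rho --> (1 : R)^'-] --> (1 : R).
  exact: (@cvg_at_left_filter _ _ id).
have epsc : 1 - rho @[rho --> (1 : R)^'-] --> (0 : R).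
  by rewrite -[X in _ --> X](subrr 1); apply: cvgB => //; exact: cvg_cst.
have slope : x rho / (1 - rho) @[rho --> 1^'-] --> s.
  have lb : s - (1 - rho) * (s ^+ 2 / 2) @[rho --> (1 : R)^'-] --> s.
    rewrite -[X in _ --> X]subr0; apply: cvgB; first exact: cvg_cst.
    by rewrite -[X in _ --> X](mul0r (s ^+ 2 / 2)); exact: cvgMl.
  apply: squeeze_cvgr lb (cvg_cst _).
  near=> rho.
  have e0 : 0 < 1 - rho by rewrite subr_gt0; near: rho; exact: nbhs_left_lt.
  have se0 : 0 <= s * (1 - rho) by rewrite mulr_ge0 ?ltW.
  have := expRN_ge1B (s * (1 - rho)); have := expRN_le_taylor2 _ se0.
  rewrite ler_pdivlMr// ler_pdivrMr// /x; set e := expR _ => h1 h2.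
  apply/andP; split; last by lra.
  rewrite (_ : _ * (1 - rho) = s * (1 - rho) - (s * (1 - rho)) ^+ 2 / 2); first by lra.
  by ring.
have xc : x rho @[rho --> (1 : R)^'-] --> (0 : R).
  rewrite -(mulr0 s); apply: cvg_trans (cvgM slope epsc).
  apply: near_eq_cvg; near=> rho; rewrite /= divfK//.
  by rewrite gt_eqF// subr_gt0; near: rho; exact: nbhs_left_lt.
have tc : rho * x rho @[rho --> (1 : R)^'-] --> (0 : R)^'+.
  have t0 : rho * x rho @[rho --> (1 : R)^'-] --> (0 : R).
    by rewrite -(mulr0 1); apply: cvgM.
  (* The limit must be one-sided, to compose with the expansions at [0^'+]; [rho * x rho] is
     positive for [rho] below and near 1. *)
  move=> A /t0 /= HA; rewrite nbhs_simpl/=; near=> rho.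
  have : 0 < rho * x rho -> A (rho * x rho) by near: rho; exact: HA.
  apply; have /andP[x0 _] : 0 < x rho <= 1.
    by apply: x01; near: rho; exact: nbhs_left_lt.
  by rewrite mulr_gt0//; near: rho; apply: nbhs_left_gt; exact: ltr01.
have rc : r t @[t --> 0^'+] --> (\int[P]_w Y w ^+ 2) / 2.
  have := laplace_expansion Y Y_ge0 Y_sq; rewrite Y_mean.
  by under eq_fun do rewrite mulr1.
have phic : phi t @[t --> 0^'+] --> (1 : R).
  have idr : (t : R) @[t --> (0 : R)^'+] --> (0 : R).
    exact: (@cvg_at_right_filter _ _ id).
  have : 1 - t + t ^+ 2 * r t @[t --> 0^'+] -->
      1 - 0 + 0 * 0 * ((\int[P]_w Y w ^+ 2) / 2).
    apply: cvgD; last by apply: cvgM => //; exact: cvgM.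
    by apply: cvgB => //; exact: cvg_cst.
  rewrite subr0 !mul0r addr0; apply: cvg_trans.
  apply: near_eq_cvg; near=> t.
  have t0 : 0 < t by near: t; exact: nbhs_right_gt.
  by rewrite phiE// gt_eqF.
(* The limit is rewritten to exhibit the limits 1 of [phi] and [1 ^+ 2] of [rho ^+ 2]. *)
rewrite -[X in _ --> X]mul1r -[X in 1 / (1 + X * _)]mul1r.
rewrite -[X in 1 / (1 + X * _ * _)](expr1n _ 2).
have main : phi (rho * x rho) /
    (1 + rho ^+ 2 * (x rho / (1 - rho)) * r (rho * x rho)) @[rho --> 1^'-] -->
    1 / (1 + 1 ^+ 2 * s * ((\int[P]_w Y w ^+ 2) / 2)).
  apply: cvgM; first exact: cvg_comp tc phic.
  apply: cvgV.
    rewrite gt_eqF// ltr_pwDl// mulr_ge0// ?mulr_ge0 ?sqr_ge0 ?(ltW s0)//.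
    by apply: Rintegral_ge0 => w _; exact: sqr_ge0.
  apply: cvgD; first exact: cvg_cst.
  apply: cvgM; last exact: cvg_comp tc rc.
  by apply: cvgM => //; exact: cvgM.
apply: cvg_trans main; apply: near_eq_cvg; near=> rho.
have rho1 : rho < 1 by near: rho; exact: nbhs_left_lt.
have rho0 : 0 < rho by near: rho; apply: nbhs_left_gt; exact: ltr01.
rewrite -heavy_traffic_pgf ?rho0//; last exact: x01.
apply: eq_Rintegral => w _.
by rewrite /scale_nat /= mulrA expRM_natr /x opprB addrC subrK mulNr.
Unshelve. all: by end_near. Qed.

End heavy_traffic.

(** * Moments of the product [Lam1 \* S] and identification of the limit law *)

Theorem theorem5p4 (R : realType) (d : measure_display) (T : measurableType d)
    (P : probability T R) (Lam1 S : {RV P >-> R})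
    (N Q : R -> {RV P >-> nat})
    (Lam1_ge0 : forall w, 0 <= Lam1 w)
    (S_ge0 : forall w, 0 <= S w)
    (indep : independent_RV P Lam1 S)
    (Lam1_sq : ('E_P[(fun w => Lam1 w ^+ 2)%R] < +oo)%E)
    (S_sq : ('E_P[(fun w => S w ^+ 2)%R] < +oo)%E)
    (normalized : ('E_P[Lam1] * 'E_P[S] = 1)%E)
    (stationary : forall rho : R, 0 < rho < 1 ->
      stationary_queue P (rho \o* Lam1 : {mfun T >-> R}) S (N rho) (Q rho)) :
  let m := 2^-1 * fine 'E_P[(fun w => Lam1 w ^+ 2)]
                * fine 'E_P[(fun w => S w ^+ 2)] in
  cvg_in_distribution P (1 : R)^'-
    (fun rho => (scale_nat (1 - rho) \o Q rho : {mfun T >-> R}))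
    (exponential_prob m^-1).
Proof.
move=> m.
pose Y : {RV P >-> R} := Lam1 \* S.
pose a := fine 'E_P[(fun w => Lam1 w ^+ 2)].
pose b := fine 'E_P[(fun w => S w ^+ 2)].
have fin_sq (Z : {RV P >-> R}) : ('E_P[(fun w => Z w ^+ 2)%R] < +oo)%E ->
    (\int[P]_w (Z w ^+ 2)%:E)%E = (fine 'E_P[(fun w => Z w ^+ 2)])%:E.
  move=> Zoo; rewrite fineK ?ge0_fin_numE// ?expectation_ge0//; first by rewrite unlock.
  by move=> w; exact: sqr_ge0.
have Ysq_integral : (\int[P]_w (Y w ^+ 2)%:E)%E = (a * b)%:E.
  transitivity (\int[P]_w ((Lam1 w ^+ 2)%:E * (S w ^+ 2)%:E))%E.
    by apply: eq_integral => w _; rewrite -EFinM -exprMn.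
  rewrite (integral_independent_prod Lam1 S indep (fun x => (x ^+ 2)%:E) (fun x => (x ^+ 2)%:E)).
  - by rewrite !fin_sq.
  - by apply/measurable_EFinP; exact: measurable_funX.
  - by apply/measurable_EFinP; exact: measurable_funX.
  - by move=> x; rewrite lee_fin sqr_ge0.
  - by move=> x; rewrite lee_fin sqr_ge0.
have Y_sq : P.-integrable setT (EFin \o fun w => Y w ^+ 2).
  apply/integrableP; split; first by apply/measurable_EFinP; exact: measurable_funX.
  rewrite (_ : (\int[P]_w _ = (a * b)%:E)%E) ?ltry// -Ysq_integral.
  by apply: eq_integral => w _; rewrite /= ger0_norm ?sqr_ge0.
have vE : \int[P]_w Y w ^+ 2 = a * b by rewrite /Rintegral Ysq_integral.
have Y_mean : \int[P]_w Y w = 1.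
  rewrite /Rintegral (_ : (\int[P]_w _ = 1)%E)// -normalized unlock.
  (* [integral_independent_prod] wants functions nonnegative on all of [R], hence the absolute
     values. *)
  transitivity (\int[P]_w (`|Lam1 w|%:E * `|S w|%:E))%E.
    by apply: eq_integral => w _; rewrite -EFinM -normrM ger0_norm// mulr_ge0.
  rewrite (integral_independent_prod Lam1 S indep (fun x => `|x|%:E) (fun x => `|x|%:E)).
  - by congr (_ * _)%E; apply: eq_integral => w _; rewrite ger0_norm.
  - by apply/measurable_EFinP; exact: normr_measurable.
  - by apply/measurable_EFinP; exact: normr_measurable.
  - by move=> x; rewrite lee_fin.
  - by move=> x; rewrite lee_fin.
have Y_ge0 w : 0 <= Y w by rewrite mulr_ge0.
have iY := integrable_of_sqr Y Y_ge0 Y_sq.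
have i1 := finite_measure_integrable_cst P (1 : R) measurableT.
(* [E Y = 1] and [Y ^ 2 >= 2 Y - 1] give [E Y ^ 2 >= 1]. *)
have m_gt0 : 0 < m.
  have : \int[P]_w (2 * Y w - 1) <= \int[P]_w Y w ^+ 2.
    apply: le_Rintegral => //.
    - exact: (integrableB measurableT (integrableZl measurableT 2 iY) i1).
    - by move=> w _; have := sqr_ge0 (Y w - 1); nra.
  rewrite (RintegralB measurableT (integrableZl measurableT 2 iY) i1).
  rewrite (RintegralZl _ measurableT iY) Rintegral_probability_cst Y_mean vE.
  by rewrite /m -/a -/b; lra.
have r_gt0 : 0 < m^-1 by rewrite invr_gt0.
pose mu : probability (measurableTypeR R) R :=
  exponential_distribution_exponential_prob__canonical__probability_measure_Probability
    r_gt0.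
have mZ : measurable_fun setT (fun x : measurableTypeR R => Num.max x 0 : R).
  exact: measurable_maxr.
pose Z : {RV mu >-> R} := mfun_Sub (mem_set mZ).
have Z_ge0 x : 0 <= Z x by rewrite /= le_max lexx orbT.
(* Nonnegativity is only eventual: the scaling [1 - rho] is negative for [rho > 1]. *)
have X_ge0 : \forall rho \near (1 : R)^'-, forall w,
    0 <= (scale_nat (1 - rho) \o Q rho : {mfun T >-> R}) w.
  near=> rho.
  have rho1 : rho < 1 by near: rho; exact: nbhs_left_lt.
  by move=> w; rewrite /= /scale_nat mulr_ge0// subr_ge0 ltW.
have lap s : 0 < s ->
    \int[P]_w expR (- s * (scale_nat (1 - rho) \o Q rho : {mfun T >-> R}) w) @[rho --> 1^'-] -->
    \int[mu]_x expR (- s * Z x).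
  move=> s0; rewrite (laplace_exponential mu _ _ r_gt0 s0)//.
  rewrite [X in _ --> X](_ : _ = (1 + s * ((\int[P]_w Y w ^+ 2) / 2))^-1).
    exact: (heavy_traffic_laplace Lam1 S N Q Y).
  rewrite vE (_ : a * b / 2 = m); last by rewrite /m -/a -/b; ring.
  (* This matches the heavy-traffic limit with the exponential transform of rate [m^-1]. *)
  have -> : 1 + s * m = (m^-1 + s) * m by rewrite mulrDl mulVf ?gt_eqF.
  by rewrite [RHS]invfM [RHS]mulrC.
(* Truncation at 0 keeps the distribution function: both sides vanish for [y < 0], and for [y >= 0]
   the events coincide. *)
have ZE : (fun y => distribution mu Z `]-oo, y]) = (fun y => exponential_prob m^-1 `]-oo, y]).
  apply/funext => y; rewrite /distribution /= /pushforward.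
  have [y0|y0] := ltP y 0.
    rewrite (_ : _ @^-1` _ = set0); last first.
      apply/seteqP; split => // x /=; rewrite in_itv/= => /(le_trans (Z_ge0 x)).
      by rewrite leNgt y0.
    rewrite [LHS](measure0 mu) [RHS]integral0_eq// => x /=; rewrite in_itv/= => xy.
    by rewrite lt0_exponential_pdf// (le_lt_trans xy).
  congr (exponential_prob _ _); apply/seteqP; split => x /=;
    by rewrite !in_itv/= ge_max y0 andbT.
move=> x cx.
have := laplace_cvg_in_distribution _ Z X_ge0 Z_ge0 lap x.
rewrite ZE (_ : distribution mu Z _ = exponential_prob m^-1 `]-oo, x]);
  last exact: (congr1 (@^~ x) ZE).
exact.
Unshelve. all: by end_near. Qed.
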